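(* The push-based remote control problem described in the context is equivalent to the single-agent POMDP $\hat{\mathcal{M}}$ described in the context: (after the encoder's decision at time $0$) deterministic pairs of encoder and decoder policies correspond to deterministic policies of $\hat{\mathcal{M}}$ with equal expected discounted objective, so that the optimal push-based policies are obtained from the optimal policy of $\hat{\mathcal{M}}$, $\hat{\boldsymbol{\pi}}^*_{\text{joint}}=\arg\max_{\hat{\boldsymbol{\pi}}:\Omega\to\hat{\mathcal{A}}}\sum_{t=0}^\infty\gamma^t\,\mathbb{E}_{\boldsymbol{\omega}_0,\hat{\boldsymbol{\pi}}}\big[\hat r(s_t,\hat{\boldsymbol{\pi}}(\boldsymbol{\omega}_t))\big]$, by splitting each chosen action $\langle a,\mathbf{c}\rangle$ into the decoder's control action $a$ and the encoder's communication decisions $\mathbf{c}$.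
   Context: Push-based problem: finite state set $\mathcal{S}$, finite control action set $\mathcal{A}$, stochastic matrices $\mathbf{P}^a$ ($a\in\mathcal{A}$) with $P^a_{s,s'}$ the probability of moving from $s$ to $s'$ under $a$, reward $r(s,a,s')$, discount $\gamma\in[0,1)$, communication cost $\beta>0$. A Markov process evolves as $s_{t+1}\sim P^{a_t}_{s_t,\cdot}$. At each time $t$ an encoder, observing $s_t$ and the past decoder observations, chooses $c_t\in\{0,1\}$; the decoder observes $o_t=s_t$ if $c_t=1$ and $o_t=\chi$ otherwise, then chooses $a_t\in\mathcal{A}$ based on $o_{0:t}$ (and its past actions). The objective is to maximize $\mathbb{E}\big[\sum_t\gamma^t(r(s_t,a_t,s_{t+1})-\beta c_t)\big]$ over deterministic encoder and decoder policies; the encoder's decision at time $0$ is optimized separately. POMDP $\hat{\mathcal{M}}$: hidden state space $\mathcal{S}$; observation space $\mathcal{S}\cup\{\chi\}$; action space $\hat{\mathcal{A}}=\mathcal{A}\times\{0,1\}^{|\mathcal{S}|}$, where an action $\langle a,\mathbf{c}\rangle$ consists of a decoder control action $a$ and an encoder communication decision $\mathbf{c}_{s}\in\{0,1\}$ for every possible next state $s$; transition $\Pr(s_{t+1}=s'\mid s_t=s,\langle a,\mathbf{c}\rangle)=P^a_{s,s'}$; after moving to $s'$ the observation is $s'$ if $\mathbf{c}_{s'}=1$ and $\chi$ if $\mathbf{c}_{s'}=0$; reward $\hat r(s,\langle a,\mathbf{c}\rangle)=\sum_{s'\in\mathcal{S}}P^a_{s,s'}\big(r(s,a,s')-\gamma\beta\,\mathbf{c}_{s'}\big)$.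 $\Omega$ is the probability simplex over $\mathcal{S}$ (beliefs), $\boldsymbol{\omega}_t$ is the belief at time $t$ and $\boldsymbol{\omega}_0$ the decoder's initial belief. *)

(* Defs.v *)
From HB Require Import structures.
From mathcomp Require Import all_boot all_order all_algebra.
From mathcomp Require Import all_classical all_reals all_analysis.
Set Implicit Arguments. Unset Strict Implicit. Unset Printing Implicit Defensive.
Import Order.TTheory GRing.Theory Num.Theory.
Import numFieldNormedType.Exports.
Local Open Scope ring_scope.

Section PushPOMDP.
Variables (R : realType) (S A : finType).
(* P a s s' = P^a_{s,s'} ; r s a s' = r(s,a,s') ; mu0 = law of s_0 *)
Variables (P : A -> S -> S -> R) (r : S -> A -> S -> R) (gamma beta : R).
Variable (mu0 : S -> R).
(* encoder decision at time 0 (fixed, optimized separately) *)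
Variable (c0 : S -> bool).

(* observation: Some s = the state s, None = the empty symbol chi *)
Definition observe (c : bool) (s : S) : option S := if c then Some s else None.

(* Expectation at time t of a functional f(s_t, o_{0:t-1}) of the state and
   the past decoder observations, for deterministic encoder/decoder policies:
   enc (o_{0:t-1}) s_t = c_t for t >= 1, dec (o_{0:t}) = a_t. *)
Section Push.
Variables (enc : seq (option S) -> S -> bool) (dec : seq (option S) -> A).

Definition push_c (hp : seq (option S)) (s : S) : bool :=
  if hp is [::] then c0 s else enc hp s.

Definition push_obs (hp : seq (option S)) (s : S) : seq (option S) :=
  rcons hp (observe (push_c hp s) s).

Fixpoint push_exp (t : nat) (f : S -> seq (option S) -> R) : R :=
  match t with
  | 0 => \sum_(s : S) mu0 s * f s [::]
  | t'.+1 => push_exp t' (fun s hp =>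
       let o := push_obs hp s in
       \sum_(s' : S) P (dec o) s s' * f s' o)
  end.

Definition push_stage (t : nat) : R :=
  push_exp t (fun s hp =>
    let o := push_obs hp s in
    \sum_(s' : S) P (dec o) s s' * r s (dec o) s' - beta * (push_c hp s)%:R).

Definition J_push : R := limn (series (fun t => gamma ^+ t * push_stage t)).
End Push.

Definition r_hat (s : S) (ac : A * (S -> bool)) : R :=
  \sum_(s' : S) P ac.1 s s' * (r s ac.1 s' - gamma * beta * (ac.2 s')%:R).

(* A deterministic policy of \hat M maps the observation history o_{0:t}
   (o_0 produced by the time-0 encoder decision c0) to an action. *)
Section POMDP.
Variable (pol : seq (option S) -> A * (S -> bool)).

(* expectation at time t of g(s_t, o_{0:t}) *)
Fixpoint pomdp_exp (t : nat) (g : S -> seq (option S) -> R) : R :=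
  match t with
  | 0 => \sum_(s : S) mu0 s * g s [:: observe (c0 s) s]
  | t'.+1 => pomdp_exp t' (fun s os =>
       let ac := pol os in
       \sum_(s' : S) P ac.1 s s' * g s' (rcons os (observe (ac.2 s') s')))
  end.

Definition pomdp_stage (t : nat) : R :=
  pomdp_exp t (fun s os => r_hat s (pol os)).

Definition J_pomdp : R := limn (series (fun t => gamma ^+ t * pomdp_stage t)).
End POMDP.

Definition split_dec (pol : seq (option S) -> A * (S -> bool)) :
  seq (option S) -> A := fun os => (pol os).1.
Definition split_enc (pol : seq (option S) -> A * (S -> bool)) :
  seq (option S) -> S -> bool := fun hp s => (pol hp).2 s.
Definition join_pol (enc : seq (option S) -> S -> bool)
  (dec : seq (option S) -> A) : seq (option S) -> A * (S -> bool) :=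
  fun os => (dec os, enc os).

(* Beliefs (elements of Omega, represented as functions S -> R). *)
Definition belief0 (o : option S) : S -> R :=
  match o with
  | Some s0 => fun s => (s == s0)%:R
  | None => let w := fun s => mu0 s * (~~ c0 s)%:R in
            fun s => w s / \sum_(x : S) w x
  end.

Definition belief_update (om : S -> R) (ac : A * (S -> bool)) (o : option S)
  : S -> R :=
  match o with
  | Some s0 => fun s => (s == s0)%:R
  | None => let w := fun s' => (\sum_(s : S) om s * P ac.1 s s') * (~~ ac.2 s')%:R in
            fun s' => w s' / \sum_(x : S) w x
  end.

Fixpoint belief_run (pib : (S -> R) -> A * (S -> bool)) (om : S -> R)
  (os : seq (option S)) : S -> R :=
  match os with
  | [::] => om
  | o :: os' => belief_run pib (belief_update om (pib om) o) os'
  end.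

Definition belief_of (pib : (S -> R) -> A * (S -> bool)) (os : seq (option S))
  : S -> R :=
  match os with
  | [::] => mu0
  | o0 :: os' => belief_run pib (belief0 o0) os'
  end.

Definition belief_policy (pib : (S -> R) -> A * (S -> bool)) :
  seq (option S) -> A * (S -> bool) := fun os => pib (belief_of pib os).

End PushPOMDP.

(* Main.v *)
(** The time-0 decision aside, the push-based objective and the objective of the
POMDP evaluated on the joined policy differ only in how communication is
charged: the push problem pays [beta] for [c_t] at time [t], while [r_hat]
pays [gamma * beta] for [c_(t+1)] one step earlier.  Writing [C t] for the
expected communication at time [t], the stage rewards therefore satisfy
[push_t = pomdp_t + beta * (gamma * C (t+1) - C t)], and the discounted sums
telescope to [J_push = J_pomdp - beta * C 0], where [C 0] is the fixed
time-0 cost; the boundary term [gamma ^ N * C N] vanishes because [C] is a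
probability and [gamma < 1], which also makes the discounted series
converge.  Since joining and splitting policies are mutually inverse, a
maximiser of [J_pomdp] splits into a maximiser of [J_push]. *)

Require Import Defs.
From HB Require Import structures.
From mathcomp Require Import all_boot all_order all_algebra.
From mathcomp Require Import all_classical all_reals all_analysis.
From mathcomp Require Import ring.
Set Implicit Arguments. Unset Strict Implicit. Unset Printing Implicit Defensive.
Import Order.TTheory GRing.Theory Num.Theory.
Import numFieldNormedType.Exports.
Local Open Scope ring_scope.

Lemma finite_norm_bounded (R : realDomainType) (T : finType) (f : T -> R) :
  exists M, forall x, `|f x| <= M.
Proof. by exists (\big[Num.max/0]_x `|f x|) => x; exact: le_bigmax. Qed.

Lemma convex_sum_norm_le (R : realDomainType) (T : finType) (w f : T -> R) M :
  (forall x, 0 <= w x) -> \sum_x w x = 1 -> (forall x, `|f x| <= M) ->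
  `|\sum_x w x * f x| <= M.
Proof.
move=> w_ge0 w_sum1 f_le; apply: le_trans (ler_norm_sum _ _ _) _.
rewrite -[leRHS]mul1r -w_sum1 mulr_suml; apply: ler_sum => x _.
by rewrite normrM ger0_norm // ler_wpM2l.
Qed.

Section DiscountedSeries.
Local Open Scope classical_set_scope.
Variables (R : realType) (g : R).

Lemma discounted_series_telescope (b : R) (u v c : nat -> R) :
  (forall t, u t = v t + b * (g * c t.+1 - c t)) ->
  forall N, series (fun t => g ^+ t * u t) N
            = series (fun t => g ^+ t * v t) N + b * (g ^+ N * c N - c 0).
Proof.
move=> uE; elim=> [|N IH].
  by rewrite /series /= !big_geq // expr0 mul1r subrr mulr0 addr0.
by rewrite !seriesSr IH uE exprS; ring.
Qed.

Hypotheses (g_ge0 : 0 <= g) (g_lt1 : g < 1).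

Let norm_g_lt1 : `|g| < 1. Proof. by rewrite ger0_norm. Qed.

Lemma cvg_discounted_bounded (c : nat -> R) K :
  (forall t, `|c t| <= K) -> g ^+ t * c t @[t --> \oo] --> 0.
Proof.
move=> c_le; have gK := cvg_geometric K norm_g_lt1.
apply: (@squeeze_cvgr _ _ _ _ (fun t => - geometric K g t) (geometric K g));
  [near=> t | by rewrite -oppr0; exact: cvgN | exact: gK].
rewrite /geometric /= -ler_norml normrM normrX ger0_norm // mulrC.
by rewrite ler_wpM2r ?exprn_ge0.
Unshelve. all: by end_near.
Qed.

Lemma is_cvg_discounted_series (v : nat -> R) M :
  (forall t, `|v t| <= M) -> cvgn (series (fun t => g ^+ t * v t)).
Proof.
move=> v_le; apply: normed_cvg; apply: (@series_le_cvg _ _ (geometric M g)).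
- by move=> t; exact: normr_ge0.
- by move=> t; rewrite /geometric /= mulr_ge0 ?exprn_ge0 // (le_trans _ (v_le 0)).
- by move=> t; rewrite /= normrM normrX ger0_norm // mulrC ler_wpM2r ?exprn_ge0.
- exact: is_cvg_geometric_series.
Qed.

Lemma discounted_limn_telescope (b : R) (u v c : nat -> R) K M :
  (forall t, u t = v t + b * (g * c t.+1 - c t)) ->
  (forall t, `|c t| <= K) -> (forall t, `|v t| <= M) ->
  limn (series (fun t => g ^+ t * u t))
  = limn (series (fun t => g ^+ t * v t)) - b * c 0.
Proof.
move=> uE c_le v_le; rewrite (funext (discounted_series_telescope uE)).
apply: cvg_lim => //; apply: cvgD; first exact: is_cvg_discounted_series v_le.
rewrite -mulrN; apply: cvgMl_tmp.
have := cvgB (cvg_discounted_bounded c_le) (cvg_cst (c 0)); rewrite sub0r; exact.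
Qed.

End DiscountedSeries.

Lemma join_pol_split (S A : finType) (pol : seq (option S) -> A * (S -> bool)) :
  join_pol (split_enc pol) (split_dec pol) = pol.
Proof. by apply: funext => os; rewrite /join_pol /split_enc /split_dec; case: (pol os). Qed.

Section PushEqualsPOMDP.
Variables (R : realType) (S A : finType).
Variables (P : A -> S -> S -> R) (r : S -> A -> S -> R) (gamma beta : R).
Variables (mu0 : S -> R) (c0 : S -> bool).
Variables (enc : seq (option S) -> S -> bool) (dec : seq (option S) -> A).

Local Notation pexp := (push_exp P mu0 c0 enc dec).
Local Notation pol := (join_pol enc dec).

Definition push_comm (t : nat) : R := pexp t (fun s hp => (push_c c0 enc hp s)%:R).

Lemma push_c_rcons hp o s : push_c c0 enc (rcons hp o) s = enc (rcons hp o) s.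
Proof. by case: hp. Qed.

Lemma push_expD t (f h : S -> seq (option S) -> R) :
  pexp t (fun s hp => f s hp + h s hp) = pexp t f + pexp t h.
Proof.
elim: t f h => [|t IH] f h /=.
  by rewrite -big_split; apply: eq_bigr => s _; rewrite mulrDr.
rewrite -IH; congr push_exp; apply: funext => s; apply: funext => hp.
by rewrite -big_split; apply: eq_bigr => s' _; rewrite mulrDr.
Qed.

Lemma push_expZ t (a : R) (f : S -> seq (option S) -> R) :
  pexp t (fun s hp => a * f s hp) = a * pexp t f.
Proof.
elim: t f => [|t IH] f /=; first by rewrite mulr_sumr; apply: eq_bigr => s _; ring.
rewrite -IH; congr push_exp; apply: funext => s; apply: funext => hp.
by rewrite mulr_sumr; apply: eq_bigr => s' _; ring.
Qed.

Lemma pomdp_exp_join t (h : S -> seq (option S) -> R) :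
  pomdp_exp P mu0 c0 pol t h = pexp t (fun s hp => h s (push_obs c0 enc hp s)).
Proof.
elim: t h => [|t IH] h //=; rewrite IH; congr push_exp.
apply: funext => s; apply: funext => hp; apply: eq_bigr => s' _.
by rewrite /push_obs push_c_rcons.
Qed.

Lemma push_comm_succ t :
  push_comm t.+1 = pexp t (fun s hp => let o := push_obs c0 enc hp s in
                                       \sum_s' P (dec o) s s' * (enc o s')%:R).
Proof.
rewrite /push_comm /=; congr push_exp; apply: funext => s; apply: funext => hp.
by apply: eq_bigr => s' _; rewrite /push_obs push_c_rcons.
Qed.

Lemma push_stage_telescope t :
  push_stage P r beta mu0 c0 enc dec t
  = pomdp_stage P r gamma beta mu0 c0 pol t
    + beta * (gamma * push_comm t.+1 - push_comm t).
Proof.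
rewrite /push_stage /pomdp_stage pomdp_exp_join push_comm_succ /push_comm.
rewrite mulrBr mulrA -mulNr -!push_expZ -!push_expD.
congr push_exp; apply: funext => s; apply: funext => hp /=.
rewrite /r_hat addrA mulr_sumr -big_split; congr (_ + _); last by rewrite mulNr.
by apply: eq_bigr => s' _ /=; ring.
Qed.

Hypotheses (P_ge0 : forall a s s', 0 <= P a s s')
           (P_sum1 : forall a s, \sum_s' P a s s' = 1)
           (mu0_ge0 : forall s, 0 <= mu0 s) (mu0_sum1 : \sum_s mu0 s = 1).

Lemma push_exp_norm_le t f M :
  (forall s hp, `|f s hp| <= M) -> `|pexp t f| <= M.
Proof.
elim: t f => [|t IH] f f_le /=; first exact: convex_sum_norm_le.
by apply: IH => s hp; apply: convex_sum_norm_le.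
Qed.

Lemma push_comm_norm_le t : `|push_comm t| <= 1.
Proof. by apply: push_exp_norm_le => s hp; case: push_c; rewrite ?normr1 ?normr0. Qed.

Lemma pomdp_stage_join_bounded :
  exists M, forall t, `|pomdp_stage P r gamma beta mu0 c0 pol t| <= M.
Proof.
have [Mr r_le] := finite_norm_bounded (fun x : S * A * S => r x.1.1 x.1.2 x.2).
exists (Mr + `|gamma * beta|) => t.
rewrite /pomdp_stage pomdp_exp_join; apply: push_exp_norm_le => s hp.
apply: convex_sum_norm_le => // s'; apply: le_trans (ler_normB _ _) _.
rewrite lerD ?(r_le (s, _, s')) // normrM.
by case: (_ s'); rewrite ?normr1 ?mulr1 ?normr0 ?mulr0.
Qed.

Hypotheses (gamma_ge0 : 0 <= gamma) (gamma_lt1 : gamma < 1).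

Lemma J_push_join :
  J_push P r gamma beta mu0 c0 enc dec
  = J_pomdp P r gamma beta mu0 c0 pol - beta * \sum_s mu0 s * (c0 s)%:R.
Proof.
have [M stage_le] := pomdp_stage_join_bounded.
(* [push_comm 0] computes to the time-0 cost. *)
exact: (discounted_limn_telescope gamma_ge0 gamma_lt1
          push_stage_telescope push_comm_norm_le stage_le).
Qed.

End PushEqualsPOMDP.

Theorem theorem3 (R : realType) (S A : finType)
  (P : A -> S -> S -> R) (r : S -> A -> S -> R) (gamma beta : R)
  (mu0 : S -> R) (c0 : S -> bool) :
  (forall a s s', 0 <= P a s s') ->
  (forall a s, \sum_(s' : S) P a s s' = 1) ->
  (forall s, 0 <= mu0 s) -> \sum_(s : S) mu0 s = 1 ->
  0 <= gamma -> gamma < 1 -> 0 < beta ->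
  let cost0 := beta * \sum_(s : S) mu0 s * (c0 s)%:R in
  (* encoder/decoder pairs -> POMDP policies, same objective *)
  (forall (enc : seq (option S) -> S -> bool) (dec : seq (option S) -> A),
     J_push P r gamma beta mu0 c0 enc dec
     = J_pomdp P r gamma beta mu0 c0 (join_pol enc dec) - cost0) /\
  (* POMDP policies -> encoder/decoder pairs (by splitting), same objective *)
  (forall pol : seq (option S) -> A * (S -> bool),
     J_push P r gamma beta mu0 c0 (split_enc pol) (split_dec pol)
     = J_pomdp P r gamma beta mu0 c0 pol - cost0) /\
  (* an optimal policy of \hat M splits into optimal push-based policies *)
  (forall pol_star : seq (option S) -> A * (S -> bool),
     (forall pol, J_pomdp P r gamma beta mu0 c0 pol
                  <= J_pomdp P r gamma beta mu0 c0 pol_star) ->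
     forall enc dec,
       J_push P r gamma beta mu0 c0 enc dec
       <= J_push P r gamma beta mu0 c0 (split_enc pol_star) (split_dec pol_star)) /\
  (* in particular for an optimal belief-based policy pi : Omega -> \hat A *)
  (forall pib : (S -> R) -> A * (S -> bool),
     (forall pol, J_pomdp P r gamma beta mu0 c0 pol
       <= J_pomdp P r gamma beta mu0 c0 (belief_policy P mu0 c0 pib)) ->
     forall enc dec,
       J_push P r gamma beta mu0 c0 enc dec
       <= J_push P r gamma beta mu0 c0
            (split_enc (belief_policy P mu0 c0 pib))
            (split_dec (belief_policy P mu0 c0 pib))).
Proof.
move=> P_ge0 P_sum1 mu0_ge0 mu0_sum1 gamma_ge0 gamma_lt1 _ cost0.
have joinE enc dec := J_push_join r beta c0 enc dec P_ge0 P_sum1 mu0_ge0 mu0_sum1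
  gamma_ge0 gamma_lt1.
have splitE pol : J_push P r gamma beta mu0 c0 (split_enc pol) (split_dec pol)
    = J_pomdp P r gamma beta mu0 c0 pol - cost0.
  by rewrite joinE join_pol_split.
have split_opt pol_star : (forall pol, J_pomdp P r gamma beta mu0 c0 pol
                  <= J_pomdp P r gamma beta mu0 c0 pol_star) ->
    forall enc dec, J_push P r gamma beta mu0 c0 enc dec
      <= J_push P r gamma beta mu0 c0 (split_enc pol_star) (split_dec pol_star).
  by move=> opt enc dec; rewrite joinE splitE lerD2r.
by split; [exact: joinE | split; [exact: splitE | split=> // pib; exact: split_opt]].
Qed.
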